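(* For real deformation parameters $0<q<1$, the braided $C^*$-quantum group $(B,\Delta_B)$ coincides with Woronowicz's quantum group $E_q(2)$; that is, $B\boxtimes_RB=B\otimes B$ and $\Delta_B\in\mathrm{Mor}(B,B\otimes B)$ is Woronowicz's comultiplication $\Delta_B(v)=v\otimes v$, $\Delta_B(n)=v\otimes n\dotplus n\otimes v^*$.
   Context: For $q\in\mathbb C$ with $0<|q|<1$ put $\zeta=q/\overline q$, $\overline{\mathbb C}^{|q|}=\{\lambda\in\mathbb C:|\lambda|\in|q|^{\mathbb Z}\}\cup\{0\}$. Let $\mathcal L=\ell^2(\mathbb Z\times\mathbb Z)$ with basis $e_{i,j}$, $ve_{i,j}=e_{i-1,j}$ (unitary), $ne_{i,j}=q^ie_{i,j+1}$ (closed normal, spectrum $\overline{\mathbb C}^{|q|}$, $vnv^*=qn$), and let $B\subset\mathbb B(\mathcal L)$ be the $C^*$-algebra generated by $v,n$ (faithful image of $C_0(\overline{\mathbb C}^{|q|})\rtimes_\alpha\mathbb Z$, $\alpha_k(f)(\lambda)=f(q^k\lambda)$); $v\in\mathcal M(B)$ and $n$ is affiliated with $B$ in Woronowicz's sense. $\mathrm{Mor}(A,D)$ denotes nondegenerate $*$-homomorphisms $A\to\mathcal M(D)$ (extended to affiliated elements), $\otimes$ the minimal tensor product, $\dotplus$ the closure of the sum of operators. $\mathbb T$ acts on $B$ with $v$ of degree $0$, $n$ of degree $1$. Let $\Psi(e_{i,j}\otimes e_{k,l})=\zeta^{-jl}e_{k,l}\otimes e_{i,j}$ on $\mathcal L\otimes\mathcal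 L$, $j_1(b)=b\otimes1$, $j_2(b)=\Psi(b\otimes1)\Psi^*$, and let $B\boxtimes_RB$ be the closed linear span of $j_1(B)j_2(B)$ in $\mathbb B(\mathcal L\otimes\mathcal L)$ (here $R(m,n)=\zeta^{mn}$ on $\mathbb Z\times\mathbb Z$). The braided $E_q(2)$ group is $(B,\Delta_B)$ with $\Delta_B\in\mathrm{Mor}(B,B\boxtimes_RB)$ given by $\Delta_B(v)=j_1(v)j_2(v)$, $\Delta_B(n)=j_1(v)j_2(n)\dotplus j_1(n)j_2(v^* )$. Woronowicz's $E_q(2)$, for real $0<q<1$, is the same $C^*$-algebra $B$ with the morphism $B\to\mathcal M(B\otimes B)$ determined by $v\mapsto v\otimes v$, $n\mapsto v\otimes n\dotplus n\otimes v^*$. *)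

(* Defs.v *)
From HB Require Import structures.
From mathcomp Require Import all_boot all_order all_algebra.
From mathcomp Require Import complex ring lra.
From mathcomp Require Import all_classical all_reals all_analysis.

Set Implicit Arguments.
Unset Strict Implicit.
Unset Printing Implicit Defensive.

Import Order.TTheory GRing.Theory Num.Theory.
Import numFieldNormedType.Exports.

Local Open Scope classical_set_scope.
Local Open Scope ring_scope.
Local Open Scope complex_scope.

Section SquareSummable.
Variable R : realType.
Local Notation C := R[i].

Definition sqmod (z : C) : R := (complex.Re z) ^+ 2 + (complex.Im z) ^+ 2.

Lemma sqmod_ge0 z : 0 <= sqmod z.
Proof. by rewrite addr_ge0 ?sqr_ge0. Qed.

Lemma sqmodM z w : sqmod (z * w) = sqmod z * sqmod w.
Proof. by case: z w => [a b] [c d]; rewrite /sqmod /=; ring. Qed.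

Lemma sqmodD z w : sqmod (z + w) <= 2 * sqmod z + 2 * sqmod w.
Proof.
case: z w => [a b] [c d]; rewrite /sqmod /= -subr_ge0.
have -> : 2 * (a ^+ 2 + b ^+ 2) + 2 * (c ^+ 2 + d ^+ 2)
          - ((a + c) ^+ 2 + (b + d) ^+ 2) = (a - c) ^+ 2 + (b - d) ^+ 2 by ring.
by rewrite addr_ge0 ?sqr_ge0.
Qed.

Definition sqsum (I : choiceType) (x : I -> C) : \bar R :=
  (\esum_(k in [set: I]) (sqmod (x k))%:E)%E.

Definition ell2_pred (I : choiceType) : {pred (I -> C)} :=
  [pred x | `[< (sqsum x < +oo)%E >]].

Variable I : choiceType.

Lemma ell2_le (x : I -> C) (y : I -> C) :
  (forall k, sqmod (x k) <= sqmod (y k)) -> y \in @ell2_pred I ->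
  x \in @ell2_pred I.
Proof.
move=> xy /asboolP yI; apply/asboolP; apply: le_lt_trans yI.
by apply: le_esum => k _; rewrite lee_fin.
Qed.

Lemma ell2_add (x y : I -> C) :
  x \in @ell2_pred I -> y \in @ell2_pred I -> x + y \in @ell2_pred I.
Proof.
move=> /asboolP xI /asboolP yI; apply/asboolP.
have s0 z : (0 <= (sqmod z)%:E)%E by rewrite lee_fin sqmod_ge0.
have s2 z : (0 <= (sqmod z + sqmod z)%:E)%E
  by rewrite lee_fin addr_ge0 ?sqmod_ge0.
apply: (@le_lt_trans _ _ (\esum_(k in [set: I])
  ((sqmod (x k) + sqmod (x k))%:E + (sqmod (y k) + sqmod (y k))%:E))%E).
  apply: le_esum => k _; rewrite -EFinD lee_fin.
  by have := sqmodD (x k) (y k); rewrite !mulr_natl !mulr2n.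
rewrite esumD//; under eq_esum do rewrite EFinD.
under [X in (_ + X)%E]eq_esum do rewrite EFinD.
by rewrite !esumD// !lte_add_pinfty.
Qed.

Lemma ell2_scale (a : C) (x : I -> C) :
  x \in @ell2_pred I -> a *: x \in @ell2_pred I.
Proof.
move=> /asboolP xI; apply/asboolP.
have s0 z : (0 <= (sqmod z)%:E)%E by rewrite lee_fin sqmod_ge0.
suff : (sqsum (a *: x)%R <= (sqmod a)%:E * sqsum x)%E.
  move/le_lt_trans; apply; apply: lte_mul_pinfty => //.
apply: ge_ereal_sup => /= _ [X [finX _]] <-.
rewrite (eq_fsbigr (fun k => (sqmod a)%:E * (sqmod (x k))%:E)%E); last first.
  by move=> k _; rewrite -EFinM -sqmodM.
rewrite -ge0_mule_fsumr//; apply: lee_wpmul2l => //.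
by apply: ereal_sup_ubound; exists X.
Qed.

Lemma ell2_submod_closed : submod_closed (@ell2_pred I).
Proof.
split=> [|a x y xI yI]; last by rewrite ell2_add// ell2_scale.
apply/asboolP; rewrite /sqsum esum1 ?ltry// => k _.
by rewrite /sqmod /= expr0n addr0.
Qed.

HB.instance Definition _ :=
  GRing.isSubmodClosed.Build C (I -> C) (@ell2_pred I) ell2_submod_closed.

Record ell2 := Ell2 { coef :> I -> C; coefP : coef \in @ell2_pred I }.

HB.instance Definition _ := [isSub for coef].
HB.instance Definition _ := [Choice of ell2 by <:].
HB.instance Definition _ := [SubChoice_isSubLmodule of ell2 by <:].

End SquareSummable.

Section Hilbert.
Variable R : realType.
Local Notation C := R[i].
Implicit Types I J : choiceType.

Definition l2norm I (x : ell2 R I) : R := Num.sqrt (fine (sqsum x)).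

(* Sum of an absolutely summable family; [esum] only handles nonnegative
   families. *)
Definition rsum I (a : I -> R) : R :=
  fine (\esum_(k in [set: I]) (Num.max (a k) 0)%:E)%E
  - fine (\esum_(k in [set: I]) (Num.max (- a k) 0)%:E)%E.

Definition csum I (a : I -> C) : C :=
  rsum (fun k => complex.Re (a k)) +i* rsum (fun k => complex.Im (a k)).

(* Antilinear in the first variable. *)
Definition inner I (x y : ell2 R I) : C := csum (fun k => conjc (x k) * y k).

Lemma esumZ_le I (c : R) (a : I -> \bar R) : 0 <= c ->
  (forall k, (0 <= a k)%E) ->
  (\esum_(k in [set: I]) (c%:E * a k) <= c%:E * \esum_(k in [set: I]) a k)%E.
Proof.
move=> c0 a0; apply: ge_ereal_sup => /= _ [X [finX _]] <-.
rewrite -ge0_mule_fsumr//; apply: lee_wpmul2l; rewrite ?lee_fin//.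
by apply: ereal_sup_ubound; exists X.
Qed.

Lemma ebasis_ell2 I (k : I) :
  (fun k' => (k' == k)%:R : C) \in @ell2_pred R I.
Proof.
apply/asboolP; rewrite /sqsum.
rewrite (eq_esum (b := fun k' => if k' \in [set k] then 1%E else 0%E)).
  by rewrite -esum_mkcond esum_set1 ?ltry.
move=> k' _; rewrite in_set1 /sqmod; case: (k' == k) => /=.
  by rewrite expr1n expr0n addr0.
by rewrite expr0n addr0.
Qed.

Definition ebasis I (k : I) : ell2 R I := Ell2 (ebasis_ell2 k).

Lemma tensv_ell2 I J (x : ell2 R I) (y : ell2 R J) :
  (fun p => x p.1 * y p.2) \in @ell2_pred R (I * J)%type.
Proof.
have /asboolP xI := coefP x; have /asboolP yJ := coefP y.
have s0 (z : C) : (0 <= (sqmod z)%:E)%E by rewrite lee_fin sqmod_ge0.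
have y0 : (0 <= sqsum y)%E by exact: esum_ge0.
have yfin : (sqsum y \is a fin_num)%E by rewrite ge0_fin_numE.
apply/asboolP; rewrite /sqsum.
have -> : [set: I * J] = [set: I] `*`` (fun=> [set: J]).
  by apply/seteqP; split.
rewrite -(esum_esum (a := fun i j => (sqmod (x i * y j))%:E)); last first.
  by move=> *; exact: s0.
apply: (@le_lt_trans _ _ ((fine (sqsum y))%:E * sqsum x)%E); last first.
  by rewrite lte_mul_pinfty// lee_fin fine_ge0.
apply: le_trans (esumZ_le _ _) => //; last by rewrite fine_ge0.
apply: le_esum => i _; under eq_esum do rewrite sqmodM EFinM.
by rewrite fineK// muleC; apply: esumZ_le => //; exact: sqmod_ge0.
Qed.

(* [L (x) L'] is realized as ell2 over the product of the index sets, with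
   [e_k (x) e_l = e_(k,l)]. *)
Definition tensv I J (x : ell2 R I) (y : ell2 R J) : ell2 R (I * J)%type :=
  Ell2 (tensv_ell2 x y).

Lemma ell2_reindex I (c : I -> C) (s t : I -> I) (x : ell2 R I) :
  (forall k, sqmod (c k) <= 1) -> cancel s t -> cancel t s ->
  (fun k => c k * x (s k)) \in @ell2_pred R I.
Proof.
move=> c1 st ts; apply: (@ell2_le _ _ _ (fun k => x (s k))).
  by move=> k; rewrite sqmodM ler_piMl ?sqmod_ge0.
have /asboolP xI := coefP x; apply/asboolP.
rewrite /sqsum
  -(reindex_esum [set: I] [set: I] s (fun k => (sqmod (x k))%:E))//.
by rewrite setTT_bijective; exists t.
Qed.

End Hilbert.

Section Operators.
Variable R : realType.
Local Notation C := R[i].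
Implicit Types I J : choiceType.

Definition op I : Type := ell2 R I -> ell2 R I.
HB.instance Definition _ I := GRing.Lmodule.on (op I).

Definition bounded_op I (T : op I) : Prop :=
  linear T /\ exists M : R, forall x, l2norm (T x) <= M * l2norm x.

(* [adj] and [tens] pick the unique operator with the given property, which
   exists as soon as their arguments are bounded. *)
Definition adj I (T : op I) : op I :=
  xget 0 [set S : op I | bounded_op S /\
            forall x y, inner (T x) y = inner x (S y)].

Definition positive_op I (T : op I) : Prop :=
  bounded_op T /\ forall x, 0 <= inner x (T x).

Definition tens I J (a : op I) (b : op J) : op (I * J)%type :=
  xget 0 [set T : op (I * J)%type | bounded_op T /\
            forall x y, T (tensv x y) = tensv (a x) (b y)].

Definition lspan (V : lmodType C) (A : set V) : set V :=
  [set x | exists (m : nat) (c : 'I_m -> C) (a : 'I_m -> V),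
     (forall i, A (a i)) /\ x = \sum_(i < m) c i *: a i].

Definition opclosure I (A : set (op I)) : set (op I) :=
  [set T | forall eps : R, 0 < eps -> exists2 S, A S &
     forall x, l2norm (T x - S x) <= eps * l2norm x].

Definition cspan I (A : set (op I)) : set (op I) := opclosure (lspan A).

(* An unbounded operator is its graph. *)
Definition graph I := set (ell2 R I * ell2 R I)%type.

Definition gr I (T : op I) : graph I := [set p | p.2 = T p.1].

Definition gclosure I (G : graph I) : graph I :=
  [set p | forall eps : R, 0 < eps -> exists2 p', G p' &
     l2norm (p.1 - p'.1) < eps /\ l2norm (p.2 - p'.2) < eps].

Definition gcomp I (G G' : graph I) : graph I :=
  [set p | exists y, G' (p.1, y) /\ G (y, p.2)].

Definition dotplus I (G G' : graph I) : graph I :=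
  gclosure [set p | exists y y', [/\ G (p.1, y), G' (p.1, y') & p.2 = y + y']].

(* The closure of the algebraic tensor product of two operators. *)
Definition gtens I J (G : graph I) (G' : graph J) : graph (I * J)%type :=
  gclosure (lspan [set p | exists x x' y y',
    [/\ G (x, x'), G' (y, y') & p = (tensv x y, tensv x' y')]]).

End Operators.

(* Below, C*-algebras act nondegenerately on ell2, so that multipliers and
   affiliated elements are operators on ell2. *)
Section Morphisms.
Variable R : realType.
Local Notation C := R[i].
Implicit Types I J : choiceType.

Definition multiplier I (A : set (op R I)) : set (op R I) :=
  [set m | bounded_op m /\ forall a, A a -> A (m \o a) /\ A (a \o m)].

Definition Mor I J (A : set (op R I)) (D : set (op R J))
    (phi : op R I -> op R J) : Prop :=
  [/\ forall a, A a -> multiplier D (phi a),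
      forall (c : C) a b, A a -> A b -> phi (c *: a + b) = c *: phi a + phi b,
      forall a b, A a -> A b -> phi (a \o b) = phi a \o phi b,
      forall a, A a -> phi (adj a) = adj (phi a) &
      cspan [set T | exists a d, [/\ A a, D d & T = phi a \o d]] = D].

(* [m'] is the image of the multiplier [m] under the canonical extension of
   [phi] to multipliers. *)
Definition mor_mult I J (A : set (op R I)) (D : set (op R J))
    (phi : op R I -> op R J) (m : op R I) (m' : op R J) : Prop :=
  [/\ multiplier A m, multiplier D m' &
      forall a, A a -> m' \o phi a = phi (m \o a)].

(* [z = T (1 + T^* T)^(-1/2)] and [S = (1 - z^* z)^(1/2) = (1 + T^* T)^(-1/2)];
   then [T = z S^(-1)]. *)
Definition ztransform I (T : graph R I) (z S : op R I) : Prop :=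
  [/\ bounded_op z, positive_op S, S \o S = id - (adj z \o z) &
      T = [set p | exists a, p = (S a, z a)]].

Definition affiliated I (A : set (op R I)) (T : graph R I) (z : op R I) :
    Prop :=
  exists S, [/\ ztransform T z S, multiplier A z &
    A `<=` opclosure [set T' | exists2 a, A a & T' = S \o a]].

(* [T'] is the image of [T], affiliated with [A], under the extension of
   [phi] to affiliated elements: z-transforms are mapped to z-transforms. *)
Definition mor_affiliated I J (A : set (op R I)) (D : set (op R J))
    (phi : op R I -> op R J) (T : graph R I) (T' : graph R J) : Prop :=
  exists z z', [/\ affiliated A T z, affiliated D T' z' &
                   mor_mult A D phi z z'].

(* The minimal tensor product, acting on [ell2 (I * J)]. *)
Definition min_tensor I J (A : set (op R I)) (D : set (op R J)) :
    set (op R (I * J)%type) :=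
  cspan [set T | exists a d, [/\ A a, D d & T = tens a d]].

End Morphisms.

Section BraidedE2.
Variable R : realType.
Local Notation C := R[i].
Local Notation Z2 := (int * int)%type.
Local Notation L := (ell2 R Z2).
Local Notation op2 := (op R (Z2 * Z2)%type).

Lemma vpow_ell2 (k : int) (x : L) :
  (fun p => x (p.1 + k, p.2)) \in @ell2_pred R Z2.
Proof.
rewrite (_ : (fun _ => _) = fun p : Z2 => 1 * x (p.1 + k, p.2)); last first.
  by apply/funext => p; rewrite mul1r.
apply: (@ell2_reindex _ _ (fun=> 1) (fun p : Z2 => (p.1 + k, p.2))
  (fun p : Z2 => (p.1 - k, p.2))).
- by move=> _; rewrite /sqmod /= expr1n expr0n addr0.
- by move=> [i j] /=; rewrite addrK.
- by move=> [i j] /=; rewrite subrK.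
Qed.

(* [v^k e_(i,j) = e_(i-k,j)] *)
Definition vpow (k : int) : op R Z2 := fun x => Ell2 (vpow_ell2 k x).

Definition shiftv : op R Z2 := vpow 1.

Definition expi (t : R) : C := cos t +i* sin t.

Definition fourier_coef (g : C -> C) (m : int) : C :=
  let h t := g (expi t) * expi (- m%:~R * t) in
  ((2 * pi)^-1)%:C *
  ((\int[lebesgue_measure]_(t in `[0, 2 * pi]) complex.Re (h t)) +i*
   (\int[lebesgue_measure]_(t in `[0, 2 * pi]) complex.Im (h t))).

Variable q : C.

Definition zeta : C := q / conjc q.

(* The closed normal operator [n], [n e_(i,j) = q^i e_(i,j+1)] on its maximal
   domain. *)
Definition normaln : graph R Z2 :=
  [set p : L * L | forall i j : int, p.2 (i, j + 1) = q ^ i * p.1 (i, j)].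

Definition spec_n : set C := [set l | l = 0 \/ exists k : int, `|l| = `|q| ^ k].

(* [C^o] carries the topology of the norm. *)
Definition C0_spec (f : C -> C) : Prop :=
  {within (spec_n : set C^o), continuous (f : C^o -> C^o)} /\
  forall eps : R, 0 < eps -> exists M : R,
    forall l, spec_n l -> M%:C < `|l| -> `|f l| < eps%:C.

(* [X = f(n)]: a Fourier transform in the second index turns [n] into the
   multiplication by [q^i z], [z] in the unit circle, hence [f(n)] into the
   multiplication by [f (q^i z)]. *)
Definition is_fun_n (f : C -> C) (X : op R Z2) : Prop :=
  bounded_op X /\ forall i j i' j' : int,
    X (ebasis R (i, j)) (i', j') =
    if i' == i then fourier_coef (fun z => f (q ^ i * z)) (j' - j) else 0.

(* The image of the crossed product of [C0(spec_n)] by [Z], i.e. the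
   C*-algebra generated by [v] and the unbounded [n] in Woronowicz's sense. *)
Definition algB : set (op R Z2) :=
  cspan [set T | exists f X (k : int),
    [/\ C0_spec f, is_fun_n f X & T = X \o vpow k]].

Lemma sqmod_zeta (m : int) : sqmod (zeta ^ m) <= 1.
Proof.
have hz : zeta = 0 \/ sqmod zeta = 1.
  rewrite /zeta; have [->|q0] := eqVneq q 0.
    by left; rewrite mul0r.
  right; have cq0 : conjc q != 0 by rewrite conjc_eq0.
  have e : sqmod (conjc q) = sqmod q.
    by case: (q) => a b; rewrite /sqmod /= sqrrN.
  have q1 : sqmod (conjc q) != 0.
    apply: contra cq0 => /eqP; rewrite /sqmod => /eqP.
    rewrite paddr_eq0 ?sqr_ge0// !sqrf_eq0 => /andP[/eqP a /eqP b].
    by apply/eqP/eqP; rewrite eq_complex a b !eqxx.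
  by apply: (mulfI q1); rewrite mulrC -sqmodM mulfVK// mulr1 e.
have s1 : sqmod (1 : C) = 1 by rewrite /sqmod /= expr1n expr0n addr0.
have s0 : sqmod (0 : C) = 0 by rewrite /sqmod /= expr0n addr0.
case: hz => hz.
  by rewrite hz exp0rz; case: (m == 0); rewrite ?s1 ?s0.
have hn (k : nat) : sqmod (zeta ^+ k) = 1.
  by elim: k => [|k IH]; rewrite ?expr0// exprS sqmodM hz IH mulr1.
case: m => k; first by rewrite -exprnP hn.
have zk0 : zeta ^+ k.+1 != 0.
  apply/eqP => k0; have := hn k.+1; rewrite k0 s0 => /eqP.
  by rewrite eq_sym oner_eq0.
rewrite NegzE -exprnN -[leLHS]mulr1 -[X in _ * X <= _](hn k.+1).
by rewrite -sqmodM mulVf ?s1.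
Qed.

Lemma Psi_ell2 (x : ell2 R (Z2 * Z2)%type) :
  (fun p => zeta ^ (- (p.2.2 * p.1.2)) * x (p.2, p.1))
    \in @ell2_pred R (Z2 * Z2)%type.
Proof.
apply: (@ell2_reindex _ _ (fun p : Z2 * Z2 => zeta ^ (- (p.2.2 * p.1.2)))
  (fun p => (p.2, p.1)) (fun p => (p.2, p.1))) => [p|[]|[]] //.
exact: sqmod_zeta.
Qed.

(* [Psi (e_(i,j) (x) e_(k,l)) = zeta^(-jl) e_(k,l) (x) e_(i,j)] *)
Definition Psi : op2 := fun x => Ell2 (Psi_ell2 x).

Definition j1 (b : op R Z2) : op2 := tens b id.

Definition j2 (b : op R Z2) : op2 := Psi \o tens b id \o adj Psi.

(* [j1] and [j2] on unbounded operators *)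
Definition j1g (T : graph R Z2) : graph R (Z2 * Z2)%type := gtens T (gr id).

Definition j2g (T : graph R Z2) : graph R (Z2 * Z2)%type :=
  gcomp (gr Psi) (gcomp (gtens T (gr id)) (gr (adj Psi))).

Definition braided_tensor : set op2 :=
  cspan [set T | exists a b, [/\ algB a, algB b & T = j1 a \o j2 b]].

Definition braided_comult (Delta : op R Z2 -> op2) : Prop :=
  [/\ Mor algB braided_tensor Delta,
      mor_mult algB braided_tensor Delta shiftv (j1 shiftv \o j2 shiftv) &
      mor_affiliated algB braided_tensor Delta normaln
        (dotplus (gcomp (gr (j1 shiftv)) (j2g normaln))
                 (gcomp (j1g normaln) (gr (j2 (adj shiftv)))))].

Definition Woronowicz_comult (Delta : op R Z2 -> op2) : Prop :=
  [/\ Mor algB (min_tensor algB algB) Delta,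
      mor_mult algB (min_tensor algB algB) Delta shiftv
        (tens shiftv shiftv) &
      mor_affiliated algB (min_tensor algB algB) Delta normaln
        (dotplus (gtens (gr shiftv) normaln)
                 (gtens normaln (gr (adj shiftv))))].

End BraidedE2.

(* Main.v *)
Require Import Defs.
From HB Require Import structures.
From mathcomp Require Import all_boot all_order all_algebra.
From mathcomp Require Import complex finmap lra.
From mathcomp Require Import all_classical all_reals all_analysis.
Import Order.TTheory GRing.Theory Num.Theory.

Set Implicit Arguments.
Unset Strict Implicit.

Local Open Scope classical_set_scope.
Local Open Scope ring_scope.
Local Open Scope complex_scope.

(** For real [q] the twist [zeta = q / conjc q] is [1], so the braiding [Psi] is
the ordinary flip, and the two constructions agree term by term.

For bounded [b] the operator [j2 b = Psi (b (x) 1) Psi^*] is [1 (x) b], hence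
[j1 a j2 b = a (x) b] ([j1_j2]), and the braided and the minimal tensor product
are closed spans of the same operators ([braided_tensor_real]). The operator
[a (x) b] is singled out by its values on elementary tensors, so this has two
halves. Existence comes from letting [a] act on the slices [x (., l)], whose
square norms add up to that of [x] ([amplification]). Uniqueness
([tens_unique]) holds because a bounded operator is determined by the basis
vectors ([bounded_eq]), every vector being the limit of its finite truncations
([finite_truncation]).

The images of [v] are then equal, and the images of [n] are compared graph by
graph: [v (x) 1] composed with [1 (x) n] is [v (x) n], and [n (x) 1] composed
with [1 (x) v^*] is [n (x) v^*] ([j1v_j2g], [j1g_j2v]). Both sides are closures
of spans of elementary pairs, and the operators in between ([Psi],
[v (x) 1], [1 (x) v^*]) only permute the basis. Being isometric bijections, they
commute with closures and spans ([gtens_transport]), which leaves an identity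
between elementary pairs. The same fact gives the adjoints [Psi^* = Psi] and
[v^* = v^(-1)] ([permutes_adj]). *)

Section Proof.
Variable R : realType.
Local Notation C := R[i].
Local Notation Z2 := (int * int)%type.

(** * The norm of a square-summable family *)

Lemma esum_ge_term {I : choiceType} (a : I -> \bar R) k :
  (forall i, (0 <= a i)%E) -> (a k <= \esum_(i in [set: I]) a i)%E.
Proof.
move=> a0; rewrite -[leLHS](esum_set1 (t := k) (a := a))// esum_mkcond.
by apply: le_esum => i _; case: ifP.
Qed.

Lemma sqsumE {I : choiceType} (x : ell2 R I) : sqsum x = ((l2norm x) ^+ 2)%:E.
Proof.
have /asboolP xI := coefP x.
have x0 : (0 <= sqsum x)%E by apply: esum_ge0 => k _; rewrite lee_fin sqmod_ge0.
by rewrite /l2norm sqr_sqrtr ?fine_ge0// fineK// ge0_fin_numE.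
Qed.

Lemma l2norm_ge0 {I : choiceType} (x : ell2 R I) : 0 <= l2norm x.
Proof. exact: sqrtr_ge0. Qed.

Lemma l2norm_le {I J : choiceType} (M : R) (x : ell2 R I) (y : ell2 R J) :
  0 <= M -> (sqsum x <= (M ^+ 2)%:E * sqsum y)%E -> l2norm x <= M * l2norm y.
Proof.
move=> M0; rewrite !sqsumE -EFinM lee_fin -exprMn => h.
by rewrite -(ler_pXn2r (n := 2)) ?nnegrE ?mulr_ge0 ?l2norm_ge0.
Qed.

Lemma sqmod_le_l2norm {I : choiceType} (x : ell2 R I) k :
  sqmod (x k) <= (l2norm x) ^+ 2.
Proof.
rewrite -lee_fin -sqsumE.
apply: (esum_ge_term (a := fun k => (sqmod (x k))%:E)) => i.
by rewrite lee_fin sqmod_ge0.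
Qed.

Lemma ell2P {I : choiceType} (x y : ell2 R I) : (forall k, x k = y k) -> x = y.
Proof. by move=> xy; apply: val_inj; apply/funext. Qed.

Lemma sqmod_eq0 (z : C) : sqmod z <= 0 -> z = 0.
Proof.
case: z => a b; rewrite /sqmod /= => h.
have /eqP : a ^+ 2 + b ^+ 2 = 0.
  by apply/eqP; rewrite eq_le h addr_ge0 ?sqr_ge0.
by rewrite paddr_eq0 ?sqr_ge0// !sqrf_eq0 => /andP[/eqP -> /eqP ->].
Qed.

Lemma l2norm0_eq0 {I : choiceType} (x : ell2 R I) : l2norm x = 0 -> x = 0.
Proof.
move=> x0; apply: ell2P => k; apply: sqmod_eq0.
by rewrite (le_trans (sqmod_le_l2norm x k))// x0 expr0n.
Qed.

Lemma l2normZ {I : choiceType} (c : C) (x : ell2 R I) :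
  l2norm (c *: x) <= Num.sqrt (sqmod c) * l2norm x.
Proof.
apply: l2norm_le; rewrite ?sqrtr_ge0// sqr_sqrtr ?sqmod_ge0//.
apply: le_trans (esumZ_le _ _) => //; rewrite ?sqmod_ge0//; last first.
  by move=> k; rewrite lee_fin sqmod_ge0.
by apply: le_esum => k _; rewrite -EFinM -sqmodM.
Qed.

(** A triangle inequality up to a factor [2], which avoids the
Cauchy-Schwarz inequality: it follows from the pointwise [sqmodD], and the
constant does not matter for boundedness or for limits. *)
Lemma l2normD {I : choiceType} (x y : ell2 R I) :
  l2norm (x + y) <= 2 * (l2norm x + l2norm y).
Proof.
have s0 (z : C) : (0 <= (2 * sqmod z)%:E)%E by rewrite lee_fin mulr_ge0 ?sqmod_ge0.
have h : (l2norm (x + y)) ^+ 2 <= 2 * (l2norm x) ^+ 2 + 2 * (l2norm y) ^+ 2.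
  rewrite -lee_fin EFinD 2!(EFinM 2) -!sqsumE.
  apply: (@le_trans _ _ (\esum_(k in [set: I])
      ((2 * sqmod (x k))%:E + (2 * sqmod (y k))%:E))%E).
    by apply: le_esum => k _; rewrite -EFinD lee_fin sqmodD.
  have dbl (z : ell2 R I) :
      (\esum_(k in [set: I]) (2 * sqmod (z k))%:E <= 2%:E * sqsum z)%E.
    under eq_esum do rewrite EFinM.
    by apply: esumZ_le => // k; rewrite lee_fin sqmod_ge0.
  by rewrite esumD//; apply: leeD.
have x0 := l2norm_ge0 x; have y0 := l2norm_ge0 y.
rewrite -(ler_pXn2r (n := 2)) ?nnegrE ?mulr_ge0 ?addr_ge0 ?l2norm_ge0//.
by apply: le_trans h _; nra.
Qed.

Lemma eq0_le_eps (a b : R) : 0 <= a -> 0 <= b ->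
  (forall e, 0 < e -> a <= e * b) -> a = 0.
Proof.
move=> a0 b0 h; apply/eqP; rewrite eq_le a0 andbT.
apply/ler_addgt0Pr => e e0; rewrite add0r.
apply: le_trans (h (e / (b + 1)) _) _.
  by rewrite divr_gt0// ltr_wpDl.
by rewrite mulrAC ler_pdivrMr ?ltr_wpDl// ler_pM2l// lerDl.
Qed.

(** The form in which limits enter below: [e * b] bounds an error made when
approximating by operators or vectors at relative distance [e]. *)
Lemma l2norm_eq {I : choiceType} (x y : ell2 R I) (b : R) : 0 <= b ->
  (forall e, 0 < e -> l2norm (x - y) <= e * b) -> x = y.
Proof.
move=> b0 h; apply/eqP; rewrite -subr_eq0; apply/eqP/l2norm0_eq0.
exact: (eq0_le_eps (l2norm_ge0 _) b0).
Qed.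

Lemma l2norm0 {I : choiceType} : l2norm (0 : ell2 R I) = 0.
Proof.
rewrite /l2norm /sqsum esum1 ?fine0 ?sqrtr0// => k _.
by rewrite /sqmod /= expr0n addr0.
Qed.

Lemma l2normN {I : choiceType} (x : ell2 R I) : l2norm (- x) = l2norm x.
Proof.
rewrite /l2norm /sqsum; congr (Num.sqrt (fine _)).
apply: eq_esum => k _; have -> : (- x) k = - x k by [].
by case: (x k) => a b; rewrite /sqmod /= !sqrrN.
Qed.

(** The basis spans a dense subspace: the square norm is a supremum of finite
partial sums, and the part of [x] outside a nearly optimal finite index set
carries the missing mass. *)
Lemma finite_truncation {I : choiceType} (x : ell2 R I) (e : R) : 0 < e ->
  exists s : seq I, l2norm (x - \sum_(k <- s) x k *: ebasis R k) < e.
Proof.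
move=> e0; have e20 : 0 < e ^+ 2 by rewrite exprn_gt0.
have fx : (sqsum x \is a fin_num) by rewrite sqsumE.
have [_ [X [finX _]] <- ltX] := ub_ereal_sup_adherent e20 fx.
exists (enum_fset (fset_set X)).
set y := \sum_(_ <- _) _.
have yE k : y k = if k \in X then x k else 0.
  have -> : y k = \sum_(j <- enum_fset (fset_set X)) x j * (k == j)%:R.
    rewrite /y -[LHS]/(val (\sum_(j <- enum_fset (fset_set X)) x j *: ebasis R j) k) raddf_sum.
    by rewrite fct_sumE; apply: eq_bigr => j _.
  have [kX|kX] := boolP (k \in X).
    rewrite (bigD1_seq k) ?fset_uniq ?in_fset_set//= eqxx mulr1 big1_seq ?addr0//.
    by move=> j /andP[jk _]; rewrite eq_sym (negbTE jk) mulr0.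
  rewrite big1_seq// => j /andP[_]; rewrite -[_ \in _]/(j \in fset_set X) in_fset_set// => jX.
  by case: eqP => [kj|]; rewrite ?mulr0//; rewrite kj jX in kX.
rewrite -(ltr_pXn2r (n := 2)) ?nnegrE ?l2norm_ge0 ?ltW//.
rewrite -lte_fin -sqsumE.
have s0 i : (0 <= (sqmod (x i))%:E)%E by rewrite lee_fin sqmod_ge0.
have -> : sqsum (x - y) = (\esum_(k in ~` X) (sqmod (x k))%:E)%E.
  rewrite [RHS]esum_mkcond; apply: eq_esum => k _.
  have -> : (x - y) k = x k - y k by [].
  rewrite yE in_setC; case: ifP => _ /=; last by rewrite subr0.
  by rewrite subrr /sqmod /= expr0n addr0.
have xE := sqsumE x; rewrite /sqsum (esumID X)// !setTI in xE.
move: ltX; rewrite -[ereal_sup _]/(sqsum x) /sqsum (esumID X)// !setTI.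
rewrite -esum_fset//.
have : (0 <= \esum_(k in X) (sqmod (x k))%:E)%E by exact: esum_ge0.
have : (0 <= \esum_(k in ~` X) (sqmod (x k))%:E)%E by exact: esum_ge0.
move: xE; case: esum => [a||]; case: esum => [b||] //= _ _ _.
rewrite -!EFinD !lte_fin; lra.
Qed.

(** * Bounded operators *)

Lemma op_lin {I K : choiceType} (T : ell2 R I -> ell2 R K) :
  linear T -> exists L : {linear ell2 R I -> ell2 R K}, T = L.
Proof.
move=> lT; pose m := GRing.isLinear.Build C _ _ _ T lT.
by exists (HB.pack_for {linear ell2 R I -> ell2 R K} T m).
Qed.

(** Makes the bound nonnegative, so that it can be used as a factor in
inequalities; it may be negative when the space is trivial. *)
Lemma bounded_opP {I : choiceType} (T : op R I) : bounded_op T ->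
  linear T /\ exists2 M, 0 <= M & forall x, l2norm (T x) <= M * l2norm x.
Proof.
move=> [lT [M hM]]; split=> //; exists (Num.max M 0).
  by rewrite le_max lexx orbT.
move=> x; apply: le_trans (hM x) _; apply: ler_wpM2r; first exact: l2norm_ge0.
by rewrite le_max lexx.
Qed.

Lemma bounded_comp {I : choiceType} (S T : op R I) :
  bounded_op S -> bounded_op T -> bounded_op (S \o T).
Proof.
move=> /bounded_opP[lS [M M0 hM]] /bounded_opP[lT [N N0 hN]]; split.
  by move=> a x y /=; rewrite lT lS.
exists (M * N) => x /=; apply: le_trans (hM _) _.
by rewrite -mulrA ler_wpM2l.
Qed.

Lemma bounded_scaleadd {I : choiceType} (c : C) (S T : op R I) :
  bounded_op S -> bounded_op T -> bounded_op (c *: S + T).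
Proof.
move=> /bounded_opP[lS [M M0 hM]] /bounded_opP[lT [N N0 hN]]; split.
  move=> a x y; rewrite -[LHS]/(c *: S (a *: x + y) + T (a *: x + y)).
  rewrite -[RHS]/(a *: (c *: S x + T x) + (c *: S y + T y)).
  by rewrite lS lT !scalerDr !scalerA (mulrC c a) !addrA (addrAC _ _ (a *: T x)).
exists (2 * (Num.sqrt (sqmod c) * M + N)) => x.
apply: le_trans (l2normD (c *: S x) (T x)) _.
rewrite -mulrA ler_pM2l// mulrDl -mulrA lerD//.
by apply: le_trans (l2normZ _ _) _; rewrite ler_wpM2l ?sqrtr_ge0.
Qed.

Lemma bounded0 {I : choiceType} : bounded_op (0 : op R I).
Proof.
split=> [a x y|]; first by rewrite -[LHS]/(0 : ell2 R I) scaler0 addr0.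
by exists 0 => x; rewrite mul0r -[X in l2norm X]/(0 : ell2 R I) l2norm0.
Qed.

Lemma bounded_lspan {I : choiceType} (A : set (op R I)) :
  A `<=` @bounded_op R I -> lspan A `<=` @bounded_op R I.
Proof.
move=> bA _ [m [c [a [Aa ->]]]].
elim/big_ind: _ => [|S T bS bT|i _]; first exact: bounded0.
  by rewrite -[S]scale1r; exact: bounded_scaleadd.
by rewrite -[_ *: _]addr0; apply: bounded_scaleadd; [exact: bA|exact: bounded0].
Qed.

(** Limits in operator norm of bounded operators are bounded. The closure is
taken among arbitrary maps, so even linearity has to be recovered in the
limit. *)
Lemma bounded_opclosure {I : choiceType} (A : set (op R I)) :
  A `<=` @bounded_op R I -> opclosure A `<=` @bounded_op R I.
Proof.
move=> bA T clT; split; last first.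
  have [S /bA/bounded_opP[lS [M M0 hM]] hS] := clT 1 ltr01.
  exists (2 * (1 + M)) => x; rewrite -(subrK (S x) (T x)).
  by apply: le_trans (l2normD _ _) _; rewrite -mulrA ler_pM2l// mulrDl lerD.
move=> a x y.
(* The three replacements of [T] by [S] cost at most [2 * b] per unit of [e]. *)
pose b := l2norm (a *: x + y) + 2 * (Num.sqrt (sqmod a) * l2norm x + l2norm y).
have b0 : 0 <= b by rewrite !(addr_ge0, mulr_ge0)// ?sqrtr_ge0 ?l2norm_ge0.
apply: (l2norm_eq (b := 2 * b)); first by rewrite mulr_ge0.
move=> e e0; have [S /bA[lS _] hS] := clT e e0.
have -> : T (a *: x + y) - (a *: T x + T y) =
    (T (a *: x + y) - S (a *: x + y)) + - (a *: (T x - S x) + (T y - S y)).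
  by rewrite lS scalerBr (addrACA (a *: T x)) -opprD opprB addrA subrK.
apply: le_trans (l2normD _ _) _; rewrite l2normN mulrCA ler_pM2l// mulrDr lerD//.
apply: le_trans (l2normD _ _) _; rewrite mulrCA ler_pM2l// mulrDr lerD//.
apply: le_trans (l2normZ _ _) _; rewrite mulrCA ler_wpM2l ?sqrtr_ge0//.
Qed.

(** Bounded operators are determined by their matrix: on a truncation of [x]
they agree, and the remainder is as small as wanted. *)
Lemma bounded_eq {I : choiceType} (S T : op R I) :
  bounded_op S -> bounded_op T ->
  (forall k, S (ebasis R k) = T (ebasis R k)) -> S = T.
Proof.
move=> /bounded_opP[/op_lin[S' ->] [M M0 hM]] /bounded_opP[/op_lin[T' ->] [N N0 hN]] ST.
apply/funext => x; apply: (l2norm_eq (b := 2 * (M + N))).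
  by rewrite mulr_ge0 ?addr_ge0.
move=> e e0; have [s hs] := finite_truncation x e0.
set y := \sum_(_ <- _) _ in hs.
have xE : S' y = T' y.
  by rewrite !linear_sum; apply: eq_bigr => k _; rewrite !linearZ_LR/= ST.
have -> : S' x - T' x = S' (x - y) + - T' (x - y).
  by rewrite (linearB S') (linearB T') xE opprB addrA subrK.
apply: le_trans (l2normD _ _) _; rewrite l2normN mulrCA ler_pM2l// mulrDr.
by apply: lerD; rewrite (mulrC e);
  [apply: le_trans (hM _) _|apply: le_trans (hN _) _]; rewrite ler_wpM2l// ltW.
Qed.

(** * Tensor products of bounded operators *)

Lemma esum_pair {I J : choiceType} (f : I * J -> \bar R) :
  (forall p, (0 <= f p)%E) ->
  (\esum_(p in [set: I * J]) f p =
   \esum_(l in [set: J]) \esum_(i in [set: I]) f (i, l))%E.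
Proof.
move=> f0; rewrite (esum_esum (a := fun l i => f (i, l)))//.
rewrite (_ : _ `*`` _ = [set: J * I]); last by apply/seteqP; split.
rewrite (reindex_esum [set: J * I] [set: I * J] (fun p => (p.2, p.1)))//.
by rewrite setTT_bijective; exists (fun p => (p.2, p.1)); case.
Qed.

Lemma slice_ell2 {I J : choiceType} (x : ell2 R (I * J)%type) (l : J) :
  (fun i => x (i, l)) \in @ell2_pred R I.
Proof.
have /asboolP := coefP x; rewrite /sqsum esum_pair => [xI|p]; last first.
  by rewrite lee_fin sqmod_ge0.
apply/asboolP; apply: le_lt_trans xI; rewrite /sqsum.
apply: (esum_ge_term (a := fun l => \esum_(i in [set: I]) (sqmod (x (i, l)))%:E)%E).
by move=> j; apply: esum_ge0 => i _; rewrite lee_fin sqmod_ge0.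
Qed.

Definition slice {I J : choiceType} (x : ell2 R (I * J)%type) (l : J) : ell2 R I :=
  Ell2 (slice_ell2 x l).

Lemma sqsum_slice {I J : choiceType} (x : ell2 R (I * J)%type) :
  (sqsum x = \esum_(l in [set: J]) sqsum (slice x l))%E.
Proof. by rewrite /sqsum esum_pair// => p; rewrite lee_fin sqmod_ge0. Qed.

(** The operator [a (x) 1], constructed by letting [a] act on each slice
[x (., l)]. It is bounded by the bound of [a], since the square norms of the
slices add up to the square norm of [x]. *)
Lemma amplification {I J : choiceType} (a : op R I) : bounded_op a ->
  exists T : op R (I * J)%type, bounded_op T /\
    forall x p, T x p = a (slice x p.2) p.1.
Proof.
move=> /bounded_opP[la [M M0 hM]].
have bd (x : ell2 R (I * J)%type) :
    (sqsum (fun p : I * J => a (slice x p.2) p.1) <= (M ^+ 2)%:E * sqsum x)%E.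
  rewrite {1}/sqsum esum_pair => [|p]; last by rewrite lee_fin sqmod_ge0.
  rewrite sqsum_slice; apply: le_trans (esumZ_le _ _); first last.
  - by move=> l; apply: esum_ge0 => i _; rewrite lee_fin sqmod_ge0.
  - exact: sqr_ge0.
  apply: le_esum => l _; rewrite -[leLHS]/(sqsum (a (slice x l))).
  rewrite !sqsumE -EFinM lee_fin -exprMn.
  by rewrite ler_pXn2r ?nnegrE ?mulr_ge0 ?l2norm_ge0.
have Tl2 x : (fun p : I * J => a (slice x p.2) p.1) \in @ell2_pred R (I * J)%type.
  apply/asboolP; apply: le_lt_trans (bd x) _.
  by rewrite sqsumE -EFinM ltry.
exists (fun x => Ell2 (Tl2 x)); split; last exact: (fun x p => erefl).
split; last by exists M => x; exact: (l2norm_le (x := Ell2 (Tl2 x)) M0 (bd x)).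
move=> c x y; apply: ell2P => p.
rewrite -[LHS]/(a (slice (c *: x + y) p.2) p.1).
rewrite -[RHS]/((c *: a (slice x p.2) + a (slice y p.2)) p.1) -la.
by congr (a _ _); apply: ell2P.
Qed.

Lemma ebasis_pair {I J : choiceType} (k : I * J) :
  ebasis R k = tensv (ebasis R k.1) (ebasis R k.2).
Proof.
apply: ell2P => p /=; case: p k => [i j] [i' j'] /=.
by rewrite -natrM mulnb -pair_eqE.
Qed.

(** Basis vectors of the product are elementary tensors, so [tens a b] is
recognized by its values on elementary tensors. *)
Lemma tens_unique {I J : choiceType} (a : op R I) (b : op R J)
    (T : op R (I * J)%type) :
  bounded_op T -> (forall x y, T (tensv x y) = tensv (a x) (b y)) ->
  tens a b = T.
Proof.
move=> bT hT; apply: xget_unique => // S [bS hS].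
by apply: bounded_eq => // k; rewrite ebasis_pair hS hT.
Qed.

Lemma ampl_tensv {I J : choiceType} (a : op R I) (x : ell2 R I) (y : ell2 R J) p :
  linear a -> a (slice (tensv x y) p.2) p.1 = tensv (a x) y p.
Proof.
have -> : slice (tensv x y) p.2 = y p.2 *: x.
  by apply: ell2P => i; rewrite /= mulrC.
by case/op_lin => L ->; rewrite linearZ/= mulrC.
Qed.

Lemma tens_id {I J : choiceType} (a : op R I) : bounded_op a ->
  bounded_op (tens a (id : op R J)) /\
  forall x p, tens a (id : op R J) x p = a (slice x p.2) p.1.
Proof.
move=> ba; have [T [bT TE]] := @amplification I J a ba.
suff -> : tens a id = T by [].
by apply: tens_unique => // x y; apply: ell2P => p; rewrite TE ampl_tensv//; case: ba.
Qed.

Lemma tens_id_bounded {I J : choiceType} (a : op R I) : bounded_op a ->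
  bounded_op (tens a (id : op R J)).
Proof. by case/(@tens_id I J). Qed.

Lemma tens_idE {I J : choiceType} (a : op R I) : bounded_op a ->
  forall x p, tens a (id : op R J) x p = a (slice x p.2) p.1.
Proof. by case/(@tens_id I J). Qed.

Lemma tens_id_tensv {I J : choiceType} (a : op R I) (x : ell2 R I) (y : ell2 R J) :
  bounded_op a -> tens a id (tensv x y) = tensv (a x) y.
Proof.
by move=> ba; apply: ell2P => p; rewrite tens_idE// ampl_tensv//; case: ba.
Qed.

(** * Adjoints and coordinate permutations *)

Lemma rsum_reindex {I : choiceType} (s t : I -> I) (a : I -> R) :
  cancel s t -> cancel t s -> rsum (fun k => a (s k)) = rsum a.
Proof.
move=> st ts; have bs : set_bij [set: I] [set: I] s.
  by rewrite setTT_bijective; exists t.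
by rewrite /rsum; congr (fine _ - fine _); rewrite [RHS](reindex_esum _ _ s _ bs).
Qed.

(** The positive and the negative part of [a] are both sums with a single
nonzero term. *)
Lemma rsum_single {I : choiceType} (a : I -> R) k :
  (forall i, i != k -> a i = 0) -> rsum a = a k.
Proof.
move=> a0.
have single (b : R -> R) : b 0 = 0 -> (forall r, 0 <= b r) ->
    fine (\esum_(i in [set: I]) (b (a i))%:E)%E = b (a k).
  move=> b0 b_ge0; rewrite (eq_esum (b := fun i =>
      if i \in [set k] then (b (a i))%:E else 0%E)).
    by rewrite -esum_mkcond esum_set1// lee_fin.
  by move=> i _; rewrite in_set1; case: eqVneq => // /a0 ->; rewrite b0.
rewrite /rsum (single (fun r => Num.max r 0)) ?(single (fun r => Num.max (- r) 0)).
- have [h|h] := leP 0 (a k).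
    by rewrite max_r ?oppr_le0// subr0.
  by rewrite max_l ?oppr_ge0 ?ltW// sub0r opprK.
- by rewrite oppr0 maxxx.
- by move=> r; rewrite le_max lexx orbT.
- by rewrite maxxx.
- by move=> r; rewrite le_max lexx orbT.
Qed.

Lemma inner_ebasis {I : choiceType} (k : I) (x : ell2 R I) :
  inner (ebasis R k) x = x k.
Proof.
rewrite /inner /csum !(@rsum_single _ _ k) /=; last 2 first.
- by move=> i /negbTE ->; rewrite conjc0 mul0r.
- by move=> i /negbTE ->; rewrite conjc0 mul0r.
by rewrite eqxx conjc1 mul1r; case: (x k).
Qed.

(** Pairing with the basis vectors recovers all coordinates, so the adjoint is
unique. *)
Lemma adj_unique {I : choiceType} (T S : op R I) : bounded_op S ->
  (forall x y, inner (T x) y = inner x (S y)) -> adj T = S.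
Proof.
move=> bS hS; apply: xget_unique => // S' [bS' hS'].
by apply/funext => y; apply: ell2P => k; rewrite -!inner_ebasis -hS' hS.
Qed.

(** [U] and [U'] are mutually inverse unitaries induced by a permutation of the
index set; [Psi], [v] and their amplifications are of this kind. *)
Definition permutes {I : choiceType} (U U' : op R I) : Prop :=
  exists s t, [/\ cancel s t, cancel t s,
    forall x k, U x k = x (s k) & forall x k, U' x k = x (t k)].

Section Permutes.
Variables (I : choiceType) (U U' : op R I).
Hypothesis UU' : permutes U U'.

Lemma permutesC : permutes U' U.
Proof. by case: UU' => s [t [? ? ? ?]]; exists t, s. Qed.

Lemma permutesK : cancel U U'.
Proof.
case: UU' => s [t [st ts hU hU']] x; apply: ell2P => k.
by rewrite hU' hU ts.
Qed.

Lemma permutes_linear : linear U.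
Proof.
case: UU' => s [t [st ts hU hU']] c x y; apply: ell2P => k.
by rewrite hU -[RHS]/(c * U x k + U y k) !hU.
Qed.

Lemma permutes_l2norm x : l2norm (U x) = l2norm x.
Proof.
case: UU' => s [t [st ts hU hU']]; rewrite /l2norm /sqsum.
under eq_esum do rewrite hU.
rewrite [X in _ = Num.sqrt (fine X)](reindex_esum [set: I] [set: I] s)//.
by rewrite setTT_bijective; exists t.
Qed.

Lemma permutes_bounded : bounded_op U.
Proof.
split; first exact: permutes_linear.
by exists 1 => x; rewrite mul1r permutes_l2norm.
Qed.

Lemma permutes_inner x y : inner (U x) y = inner x (U' y).
Proof.
case: UU' => s [t [st ts hU hU']]; rewrite /inner /csum.
rewrite -[X in _ = X +i* _](rsum_reindex _ st ts).
rewrite -[X in _ = _ +i* X](rsum_reindex _ st ts).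
by congr Complex; congr rsum; apply/funext => k; rewrite hU hU' st.
Qed.
End Permutes.

Lemma permutes_adj {I : choiceType} (U U' : op R I) : permutes U U' -> adj U = U'.
Proof.
move=> UU'; apply: adj_unique; first exact: permutes_bounded (permutesC UU').
exact: permutes_inner.
Qed.

Lemma permutes_comp {I : choiceType} (U U' V V' : op R I) :
  permutes U U' -> permutes V V' -> permutes (U \o V) (V' \o U').
Proof.
move=> [s [t [st ts hU hU']]] [s' [t' [st' ts' hV hV']]].
exists (s' \o s), (t \o t'); split; [exact: can_comp|exact: can_comp| |];
  by move=> x k; rewrite /= ?hU ?hV ?hU' ?hV' ?hU'.
Qed.

(** * Transport of closed spans of graphs *)

Lemma lspan_transport (V W : lmodType C) (f : V -> W) (g : W -> V) (A : set W) :
  linear f -> cancel f g -> cancel g f ->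
  [set p | lspan A (f p)] = lspan [set p | A (f p)].
Proof.
move=> lf fg gf; pose m := GRing.isLinear.Build C _ _ _ f lf.
pose L := HB.pack_for {linear V -> W} f m.
have fL : f = L by [].
apply/seteqP; split=> p.
  move=> [n [c [a [Aa fp]]]]; exists n, c, (g \o a); split.
    by move=> i /=; rewrite gf.
  apply: (can_inj fg); rewrite fp fL linear_sum; apply: eq_bigr => i _.
  by rewrite linearZ -fL /= gf.
move=> [n [c [a [Aa ->]]]]; exists n, c, (f \o a); split=> //.
by rewrite fL linear_sum; apply: eq_bigr => i _; rewrite linearZ.
Qed.

Lemma gclosure_transport {I : choiceType} (U U' V V' : op R I) (G : graph R I) :
  permutes U U' -> permutes V V' ->
  [set p | gclosure G (U p.1, V p.2)] = gclosure [set p | G (U p.1, V p.2)].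
Proof.
move=> UU' VV'.
have dist W W' (WW' : permutes W W') (x y : ell2 R I) :
    l2norm (W x - W y) = l2norm (x - y).
  have [L LE] := op_lin (permutes_linear WW').
  by rewrite -[RHS](permutes_l2norm WW') LE linearB.
apply/seteqP; split=> p h e e0.
  have [[x y] Gxy /= [h1 h2]] := h e e0; exists (U' x, V' y) => /=.
    by rewrite (permutesK (permutesC UU')) (permutesK (permutesC VV')).
  by rewrite -(dist _ _ UU' p.1) -(dist _ _ VV' p.2)
    (permutesK (permutesC UU')) (permutesK (permutesC VV')).
have [[x y] Gxy /= [h1 h2]] := h e e0; exists (U x, V y) => //=.
by rewrite (dist _ _ UU') (dist _ _ VV').
Qed.

(** Unitaries commute with closures and spans, so to identify the preimage of a
tensor product of graphs under [U x V] it suffices to compare elementary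
pairs. *)
Lemma gtens_transport {I : choiceType} (U U' V V' : op R (I * I)%type)
    (G H G' H' : graph R I) :
  permutes U U' -> permutes V V' ->
  (forall p, (exists x x' y y', [/\ G (x, x'), H (y, y') &
       (U p.1, V p.2) = (tensv x y, tensv x' y')]) <->
     (exists x x' y y', [/\ G' (x, x'), H' (y, y') &
       p = (tensv x y, tensv x' y')])) ->
  [set p | gtens G H (U p.1, V p.2)] = gtens G' H'.
Proof.
move=> UU' VV' E; rewrite (gclosure_transport _ UU' VV'); congr gclosure.
rewrite (lspan_transport (f := fun p => (U p.1, V p.2)) (g := fun p => (U' p.1, V' p.2))).
- by congr lspan; apply/funext => p; apply/propext; exact: E.
- move=> c [x y] [x' y']; rewrite -[RHS]/(c *: U x + U x', c *: V y + V y') /=.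
  by rewrite (permutes_linear UU') (permutes_linear VV').
- by move=> [x y] /=; rewrite (permutesK UU') (permutesK VV').
- by move=> [x y] /=; rewrite (permutesK (permutesC UU')) (permutesK (permutesC VV')).
Qed.

(** * The shift and the flip *)

Lemma vpow_permutes (k : int) : permutes (vpow k : op R Z2) (vpow (- k)).
Proof.
exists (fun p => (p.1 + k, p.2)), (fun p => (p.1 - k, p.2)); split=> //.
- by case=> i j /=; rewrite addrK.
- by case=> i j /=; rewrite subrK.
Qed.

Lemma algB_bounded (q : C) : algB q `<=` @bounded_op R Z2.
Proof.
apply: bounded_opclosure; apply: bounded_lspan => T [f [X [k [_ [bX _] ->]]]].
exact: bounded_comp bX (permutes_bounded (vpow_permutes k)).
Qed.

Lemma adj_shiftv : adj (@shiftv R) = vpow (- 1).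
Proof. exact: permutes_adj (vpow_permutes 1). Qed.

Lemma tens_vpow_permutes (k : int) :
  permutes (tens (vpow k : op R Z2) (id : op R Z2)) (tens (vpow (- k)) id).
Proof.
exists (fun p => ((p.1.1 + k, p.1.2), p.2)), (fun p => ((p.1.1 - k, p.1.2), p.2)).
split.
- by case=> [[i j] l] /=; rewrite addrK.
- by case=> [[i j] l] /=; rewrite subrK.
- by move=> x p; rewrite (tens_idE (permutes_bounded (vpow_permutes k))).
- by move=> x p; rewrite (tens_idE (permutes_bounded (vpow_permutes (- k)))).
Qed.

Local Arguments Psi : simpl never.
Local Arguments vpow : simpl never.

Section RealParameter.
Variable q : R.
Hypothesis q0 : 0 < q.

Lemma zeta_real : zeta q%:C = 1.
Proof.
by rewrite /zeta conjc_real divff// eq_complex /= gt_eqF.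
Qed.

Lemma PsiE x p : Psi q%:C x p = x (p.2, p.1).
Proof. by rewrite /Psi /= zeta_real exp1rz mul1r. Qed.

Lemma Psi_permutes : permutes (Psi q%:C) (Psi q%:C).
Proof.
exists (fun p => (p.2, p.1)), (fun p => (p.2, p.1)).
by split; [case|case|exact: PsiE|exact: PsiE].
Qed.

Lemma adj_Psi : adj (Psi q%:C) = Psi q%:C.
Proof. exact: permutes_adj Psi_permutes. Qed.

Lemma Psi_tensv (x y : ell2 R Z2) : Psi q%:C (tensv x y) = tensv y x.
Proof. by apply: ell2P => p; rewrite PsiE /= mulrC. Qed.

Lemma j2_bounded (b : op R Z2) : bounded_op b -> bounded_op (j2 q%:C b).
Proof.
move=> bb; rewrite /j2 adj_Psi; have bPsi := permutes_bounded Psi_permutes.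
exact: bounded_comp (bounded_comp bPsi (tens_id_bounded bb)) bPsi.
Qed.

(** The second leg of the flip braiding is [1 (x) b]. *)
Lemma j2_tensv (b : op R Z2) (x y : ell2 R Z2) : bounded_op b ->
  j2 q%:C b (tensv x y) = tensv x (b y).
Proof.
by move=> bb; rewrite /j2 adj_Psi /= Psi_tensv tens_id_tensv// Psi_tensv.
Qed.

Lemma j1_j2 (a b : op R Z2) : bounded_op a -> bounded_op b ->
  j1 a \o j2 q%:C b = tens a b.
Proof.
move=> ba bb; apply/esym/tens_unique.
  exact: bounded_comp (tens_id_bounded ba) (j2_bounded bb).
by move=> x y /=; rewrite j2_tensv// /j1 tens_id_tensv.
Qed.

Lemma braided_tensor_real :
  braided_tensor q%:C = min_tensor (algB q%:C) (algB q%:C).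
Proof.
congr cspan; apply/seteqP; split=> T [a [b [Ba Bb ->]]]; exists a, b; split=> //;
  by rewrite j1_j2//; exact: algB_bounded Ba || exact: algB_bounded Bb.
Qed.

(** With [V = v (x) 1], the left side consists of the pairs whose image under
[Psi x (Psi V^(-1))] lies in [G (x) 1]. *)
Lemma j1v_j2g (G : graph R Z2) :
  gcomp (gr (j1 (@shiftv R))) (j2g q%:C G) = gtens (gr (@shiftv R)) G.
Proof.
have VV' := tens_vpow_permutes 1; have PP := Psi_permutes.
have vv' := vpow_permutes 1.
have bv := permutes_bounded vv'.
have bv' := permutes_bounded (permutesC vv').
have VK := permutesK VV'; have V'K := permutesK (permutesC VV').
rewrite -(gtens_transport (G := G) (H := gr id) PP
  (permutes_comp PP (permutesC VV'))); last first.
  (* The flip moves the factor carrying [G] to the second place. *)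
  move=> [p1 p2] /=; split=> -[x [x' [y [y']]]].
    rewrite /gr /= => -[Gx -> /pair_equal_spec[e1 e2]]; exists y, (vpow 1 y), x, x'; split=> //.
    rewrite -[p1](permutesK PP) e1 Psi_tensv; congr pair.
    rewrite -[p2]V'K -[X in tens _ _ X](permutesK PP) e2.
    by rewrite Psi_tensv tens_id_tensv.
  rewrite /gr /= => -[-> Gy /pair_equal_spec[-> ->]]; exists y, y', x, x; split=> //.
  rewrite Psi_tensv tens_id_tensv// Psi_tensv.
  by rewrite (permutesK vv').
apply/seteqP; split=> -[p1 p2].
  move=> [y [[z [[w [w_p1 Gwz] yz]] p2y]]] /=.
  move: w_p1 yz p2y Gwz; rewrite /gr /= => -> -> ->.
  by rewrite VK (permutesK PP) adj_Psi.
move=> /= h; exists (tens (vpow (- 1)) id p2); split; last by rewrite /gr /= /j1 V'K.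
exists (Psi q%:C (tens (vpow (- 1)) id p2)); split; last by rewrite /gr /= (permutesK PP).
by exists (Psi q%:C p1); split=> //; rewrite /gr /= adj_Psi.
Qed.

(** Here the left side is the preimage of [G (x) 1] under [(1 (x) v^(-1)) x 1];
invertibility of [v] makes every elementary pair [(x (x) y, x' (x) y)] an
image. *)
Lemma j1g_j2v (G : graph R Z2) :
  gcomp (j1g G) (gr (j2 q%:C (adj (@shiftv R)))) = gtens G (gr (adj (@shiftv R))).
Proof.
have PP := Psi_permutes; have vv' := vpow_permutes 1.
have bv := permutes_bounded vv'.
have bv' := permutes_bounded (permutesC vv').
have j2P : permutes (j2 q%:C (vpow (- 1))) (j2 q%:C (vpow 1)).
  rewrite /j2 adj_Psi.
  exact: permutes_comp (permutes_comp PP (permutesC (tens_vpow_permutes 1))) PP.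
have idP : permutes (id : op R (Z2 * Z2)%type) id by exists id, id.
rewrite adj_shiftv -(gtens_transport (G := G) (H := gr id) j2P idP); last first.
  move=> [p1 p2] /=; split=> -[x [x' [y [y']]]].
    rewrite /gr /= => -[Gx -> /pair_equal_spec[e1 ->]]; exists x, x', (vpow 1 y), y; split=> //.
      by rewrite (permutesK vv').
    by rewrite -[p1](permutesK j2P) e1 j2_tensv.
  rewrite /gr /= => -[Gx -> /pair_equal_spec[-> ->]]; exists x, x', (vpow (- 1) y), (vpow (- 1) y).
  by split=> //; rewrite j2_tensv.
apply/seteqP; split=> -[p1 p2]; first by case=> w []; rewrite /gr /= => ->.
by move=> h; exists (j2 q%:C (vpow (- 1)) p1).
Qed.
End RealParameter.
End Proof.

Unset Implicit Arguments.

Theorem corollary5p11 (R : realType) (q : R) (hq0 : 0 < q) (hq1 : q < 1) :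
  braided_tensor q%:C = min_tensor (algB q%:C) (algB q%:C) /\
  forall Delta : op R (int * int)%type ->
                 op R ((int * int) * (int * int))%type,
    braided_comult q%:C Delta <-> Woronowicz_comult q%:C Delta.
Proof.
have bv : bounded_op (@shiftv R) := permutes_bounded (vpow_permutes R 1).
split; first exact: braided_tensor_real hq0.
move=> Delta; rewrite /braided_comult /Woronowicz_comult.
rewrite (braided_tensor_real hq0) (j1_j2 hq0 bv bv) (j1v_j2g hq0) (j1g_j2v hq0).
exact: iff_refl.
Qed.
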